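(* Let $n=k+m$ with $0\le k<n$, $[n]=\{1,\dots,n\}$, $X_k^+=\{k+1,\dots,n\}$, $\alpha\in\{0,1\}$. Let $r=\mathrm{id}-2\alpha\sum_{x\in X_k^+}e_{x,x}\otimes e_{x,x}\in\mathrm{End}(\mathbb C^n\otimes\mathbb C^n)$ and $R(\lambda)=\lambda r+\mathrm P$. Let $L(\lambda)=\sum_{x,y\in[n]}e_{x,y}\otimes L_{x,y}(\lambda)$, $L_{x,y}(\lambda)=\sum_{p\ge 0}\lambda^{-p}L^{(p)}_{x,y}$, where $L^{(0)}_{x,y}=\delta_{x,y}h_x$ with: $h_x=1$ for all $x\in[n]$ if $\alpha=0$; and, if $\alpha=1$, $h_x=1$ for $x\in[k]$, while for $x\in X_k^+$ the element $h_x$ is an invertible generator (not set equal to $1$). Let $Y(\mathfrak g_\alpha(k,m))$ be the quantum algebra associated with $R$ and this $L$, i.e. the unital associative $\mathbb C$-algebra generated by these elements subject to the RTT relation $$R_{12}(\lambda_1-\lambda_2)L_1(\lambda_1)L_2(\lambda_2)=L_2(\lambda_2)L_1(\lambda_1)R_{12}(\lambda_1-\lambda_2).$$ Then $Y(\mathfrak g_\alpha(k,m))$ is the algebra generated by the elements $L^{(p)}_{x,y}$ ($x,y\in[n]$, $p\in\mathbb N$), with $L^{(0)}_{x,y}=\delta_{x,y}h_x$ (where $h_x=1$ for all $x\in[n]$ if $\alpha=0$, and, if $\alpha=1$, $h_x=1$ for $x\in[k]$ and $h_x$ is an invertible generator for $x\in X_k^+$), and the relations, for all $x,y,z,w\in[n]$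 and $l,p\in\mathbb N=\{0,1,2,\dots\}$: if $\alpha=1$: $[h_x,h_y]=0$ for $x,y\in X_k^+$, and $[L^{(p)}_{x,y},h_z]=2L^{(p)}_{x,y}h_x\,\delta_{z,x}-2h_yL^{(p)}_{x,y}\,\delta_{z,y}$ for $z\in X_k^+$; for $\alpha\in\{0,1\}$: $$[L^{(p+1)}_{x,y},L^{(l)}_{z,w}]-[L^{(p)}_{x,y},L^{(l+1)}_{z,w}]-2\alpha\big(L^{(p+1)}_{x,y}L^{(l)}_{x,w}-L^{(p)}_{x,y}L^{(l+1)}_{x,w}\big)\delta_{x,z}\mathbf 1_{x\in X_k^+}+2\alpha\big(L^{(l)}_{z,y}L^{(p+1)}_{x,y}-L^{(l+1)}_{z,y}L^{(p)}_{x,y}\big)\delta_{y,w}\mathbf 1_{y\in X_k^+}=L^{(l)}_{z,y}L^{(p)}_{x,w}-L^{(p)}_{z,y}L^{(l)}_{x,w},$$ where $[\mathrm a,\mathrm b]=\mathrm a\mathrm b-\mathrm b\mathrm a$.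
   Context: $e_{x,y}\in\mathrm{End}(\mathbb C^n)$ are the elementary matrices and $\mathrm P=\sum_{x,y}e_{x,y}\otimes e_{y,x}$ is the permutation map on $\mathbb C^n\otimes\mathbb C^n$. All tensor products are ordinary (ungraded): $(a\otimes b)(c\otimes d)=ac\otimes bd$. $\mathbf 1_{x\in X_k^+}$ is $1$ if $x\in X_k^+$ and $0$ otherwise. RTT (FRT) construction: for a quantum algebra $\mathfrak A$ and $L(\lambda)\in\mathrm{End}(\mathbb C^n)\otimes\mathfrak A[[\lambda^{-1}]]$, one writes, in $\mathrm{End}(\mathbb C^n)\otimes\mathrm{End}(\mathbb C^n)\otimes\mathfrak A$, $R_{12}=R\otimes 1_{\mathfrak A}$, $L_1=\sum_{x,y}e_{x,y}\otimes\mathrm{id}_n\otimes L_{x,y}$, $L_2=\sum_{x,y}\mathrm{id}_n\otimes e_{x,y}\otimes L_{x,y}$. The RTT relation is an identity of formal series in $\lambda_1,\lambda_2$, i.e. all coefficients of the monomials $\lambda_1^{-p}\lambda_2^{-l}$ (including those with a positive power of $\lambda_1$ or $\lambda_2$ arising from the factor $\lambda_1-\lambda_2$) are equated. The algebra it defines is the quotient of the free unital associative $\mathbb C$-algebra on the generators (the $L^{(p)}_{x,y}$ with $p\ge1$ and, for $\alpha=1$, $h_x^{\pm1}$ with $x\in X_k^+$) by these relations and $h_xh_x^{-1}=h_x^{-1}h_x=1$. *)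

(* Defs.v *)
From HB Require Import structures.
From mathcomp Require Import all_boot all_order all_algebra generic_quotient.
From mathcomp Require Import finmap monalg mxtens complex.
From mathcomp Require Import boolp classical_sets functions fsbigop reals.

Set Implicit Arguments.
Unset Strict Implicit.
Unset Printing Implicit Defensive.

Import GRing.Theory.
Local Open Scope ring_scope.
Local Open Scope classical_set_scope.
Local Open Scope quotient_scope.

Definition two_sided_ideal (A : pzRingType) (J : set A) : Prop :=
  [/\ J 0, forall u v, J u -> J v -> J (u + v),
      forall a u, J u -> J (a * u) & forall u a, J u -> J (u * a)].

Definition ideal_gen (A : pzRingType) (S : set A) : set A :=
  smallest (@two_sided_ideal A) S.

Lemma ideal_gen_ideal (A : pzRingType) (S : set A) :
  two_sided_ideal (ideal_gen S).
Proof.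
split=> [J [[] //]|u v Ju Jv J JS|a u Ju J JS|u a Ju J JS].
- by case: (JS) => -[_ + _ _] _; apply; [exact: Ju|exact: Jv].
- by case: (JS) => -[_ _ + _] _; apply; exact: Ju.
- by case: (JS) => -[_ _ _ +] _; apply; exact: Ju.
Qed.

Section Quotient.
Variables (K : nzRingType) (A : algType K) (S : set A).

Let J := ideal_gen S.
Let J0 : J 0. Proof. by case: (ideal_gen_ideal S). Qed.
Let JD u v : J u -> J v -> J (u + v).
Proof. by case: (ideal_gen_ideal S) => _ + _ _; apply. Qed.
Let JMl a u : J u -> J (a * u).
Proof. by case: (ideal_gen_ideal S) => _ _ + _; apply. Qed.
Let JMr u a : J u -> J (u * a).
Proof. by case: (ideal_gen_ideal S) => _ _ _; apply. Qed.
Let JN u : J u -> J (- u).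
Proof. by move=> Ju; rewrite -mulN1r; exact: JMl. Qed.

Definition ideal_equiv (u v : A) : bool := `[< ideal_gen S (u - v) >].

Lemma ideal_equiv_class : equiv_class_of ideal_equiv.
Proof.
split=> [u|u v|v u w].
- by apply/asboolP; rewrite subrr; exact: J0.
- by apply/asboolP/asboolP => /JN; rewrite opprB.
- move=> /asboolP uv /asboolP vw; apply/asboolP.
  by rewrite -(subrKA v); exact: JD.
Qed.

Canonical ideal_equiv_equiv := EquivRelPack ideal_equiv_class.
Canonical ideal_equiv_encModRel := defaultEncModRel ideal_equiv.

(* The quotient of A by the two-sided ideal generated by S.  It may be the
   zero ring, so its algebra structure is given as pzRingType and lmodType
   together with alg_quot_scalerAl and alg_quot_scalerAr. *)
Definition alg_quot := {eq_quot ideal_equiv}.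
HB.instance Definition _ : EqQuotient A ideal_equiv alg_quot :=
  EqQuotient.on alg_quot.
HB.instance Definition _ := Choice.on alg_quot.

Lemma eq_alg_quot (u v : A) :
  \pi_alg_quot u = \pi_alg_quot v <-> ideal_gen S (u - v).
Proof.
by split=> [/eqmodP/asboolP //|uv]; apply/eqmodP/asboolP.
Qed.

Definition quot_add (a b : alg_quot) := \pi_alg_quot (repr a + repr b).
Definition quot_opp (a : alg_quot) := \pi_alg_quot (- repr a).
Definition quot_mul (a b : alg_quot) := \pi_alg_quot (repr a * repr b).
Definition quot_scale (c : K) (a : alg_quot) := \pi_alg_quot (c *: repr a).

Let reprP u : J (repr (\pi_alg_quot u) - u).
Proof. by apply/eq_alg_quot; rewrite reprK. Qed.

Lemma pi_quot_add u v :
  quot_add (\pi_alg_quot u) (\pi_alg_quot v) = \pi_alg_quot (u + v).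
Proof. by apply/eq_alg_quot; rewrite opprD addrACA; exact: JD. Qed.

Lemma pi_quot_opp u : quot_opp (\pi_alg_quot u) = \pi_alg_quot (- u).
Proof. by apply/eq_alg_quot; rewrite -opprD; exact: JN. Qed.

Lemma pi_quot_mul u v :
  quot_mul (\pi_alg_quot u) (\pi_alg_quot v) = \pi_alg_quot (u * v).
Proof.
apply/eq_alg_quot.
rewrite -(subrKA (u * repr (\pi_alg_quot v))) -mulrBl -mulrBr.
by apply: JD; [exact: JMr|exact: JMl].
Qed.

Lemma pi_quot_scale c u :
  quot_scale c (\pi_alg_quot u) = \pi_alg_quot (c *: u).
Proof.
by apply/eq_alg_quot; rewrite -scalerBr -mulr_algl; exact: JMl.
Qed.

Let piP (P : alg_quot -> Prop) : (forall u, P (\pi_alg_quot u)) -> forall a, P a.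
Proof. by move=> Ppi a; rewrite -[a]reprK. Qed.

Let addA : associative quot_add.
Proof. by do 3!elim/piP=> ?; rewrite !pi_quot_add addrA. Qed.
Let addC : commutative quot_add.
Proof. by do 2!elim/piP=> ?; rewrite !pi_quot_add addrC. Qed.
Let add0 : left_id (\pi_alg_quot 0) quot_add.
Proof. by elim/piP=> ?; rewrite pi_quot_add add0r. Qed.
Let addN : left_inverse (\pi_alg_quot 0) quot_opp quot_add.
Proof. by elim/piP=> ?; rewrite pi_quot_opp pi_quot_add addNr. Qed.
HB.instance Definition _ := GRing.isZmodule.Build alg_quot addA addC add0 addN.

Let mulA : associative quot_mul.
Proof. by do 3!elim/piP=> ?; rewrite !pi_quot_mul mulrA. Qed.
Let mul1q : left_id (\pi_alg_quot 1) quot_mul.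
Proof. by elim/piP=> ?; rewrite pi_quot_mul mul1r. Qed.
Let mulq1 : right_id (\pi_alg_quot 1) quot_mul.
Proof. by elim/piP=> ?; rewrite pi_quot_mul mulr1. Qed.
Let mulDl : left_distributive quot_mul +%R.
Proof.
do 3!elim/piP=> ?.
by rewrite /GRing.add/= !(pi_quot_mul, pi_quot_add) mulrDl.
Qed.
Let mulDr : right_distributive quot_mul +%R.
Proof.
do 3!elim/piP=> ?.
by rewrite /GRing.add/= !(pi_quot_mul, pi_quot_add) mulrDr.
Qed.
HB.instance Definition _ :=
  GRing.Zmodule_isPzRing.Build alg_quot mulA mul1q mulq1 mulDl mulDr.

Let scaleA a b u : quot_scale a (quot_scale b u) = quot_scale (a * b) u.
Proof. by elim/piP: u => ?; rewrite !pi_quot_scale scalerA. Qed.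
Let scale1 : left_id 1 quot_scale.
Proof. by elim/piP=> ?; rewrite pi_quot_scale scale1r. Qed.
Let scaleDr : right_distributive quot_scale +%R.
Proof.
move=> c; do 2!elim/piP=> ?.
by rewrite /GRing.add/= !(pi_quot_scale, pi_quot_add) scalerDr.
Qed.
Let scaleDl u : {morph quot_scale^~ u : a b / a + b}.
Proof.
move=> a b; elim/piP: u => ?.
by rewrite [in RHS]/GRing.add/= !(pi_quot_scale, pi_quot_add) scalerDl.
Qed.
HB.instance Definition _ :=
  GRing.Zmodule_isLmodule.Build K alg_quot scaleA scale1 scaleDr scaleDl.

Lemma pi_alg_quotD : {morph \pi_alg_quot : u v / u + v}.
Proof. by move=> u v; rewrite -pi_quot_add. Qed.
Lemma pi_alg_quotM : {morph \pi_alg_quot : u v / u * v}.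
Proof. by move=> u v; rewrite -pi_quot_mul. Qed.
Lemma pi_alg_quotZ c : {morph \pi_alg_quot : u / c *: u}.
Proof. by move=> u; rewrite -pi_quot_scale. Qed.

Lemma alg_quot_scalerAl (c : K) (a b : alg_quot) : c *: (a * b) = (c *: a) * b.
Proof.
elim/piP: a => ?; elim/piP: b => ?.
by rewrite -pi_alg_quotM -!pi_alg_quotZ -pi_alg_quotM scalerAl.
Qed.
Lemma alg_quot_scalerAr (c : K) (a b : alg_quot) : c *: (a * b) = a * (c *: b).
Proof.
elim/piP: a => ?; elim/piP: b => ?.
by rewrite -pi_alg_quotM -!pi_alg_quotZ -pi_alg_quotM scalerAr.
Qed.

End Quotient.

Section FreeAlgebra.
Variables (K : comNzRingType) (I : choiceType).

Definition free_alg := {malg K[{fmonom I}]}.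
HB.instance Definition _ := GRing.Lalgebra.on free_alg.

Lemma free_alg_scalerAr (c : K) (u v : free_alg) : c *: (u * v) = u * (c *: v).
Proof.
have central (g : free_alg) : c%:MP * g = g * c%:MP.
  rewrite !malgM_def fgmulUg fgmulgU; apply: eq_bigr => q _.
  by rewrite mul1m mulm1 mulrC.
by rewrite -!mul_malgC mulrA central -mulrA.
Qed.
HB.instance Definition _ :=
  GRing.Lalgebra_isAlgebra.Build K free_alg free_alg_scalerAr.

Definition free_gen (i : I) : free_alg := << fmu i >>.

End FreeAlgebra.

(* E u v is the relation u = v. *)
Definition presented_alg (K : comNzRingType) (I : choiceType)
    (E : free_alg K I -> free_alg K I -> Prop) :=
  alg_quot [set w | exists u v, E u v /\ w = u - v].

Definition pres_gen (K : comNzRingType) (I : choiceType)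
    (E : free_alg K I -> free_alg K I -> Prop) (i : I) : presented_alg E :=
  \pi_(presented_alg E) (free_gen K i).

(* Formal series in lambda_1, lambda_2: the value at (p, l) is the coefficient
   of lambda_1^(-p) lambda_2^(-l).  Addition is pointwise. *)
Definition series2 (A : Type) := int * int -> A.

Section Series.
Variable A : pzRingType.

(* Cauchy product; \sum_(t \in setT) is a finite-support sum, and is 0 by
   convention when the support is infinite. *)
Definition series2_mul (f g : series2 A) : series2 A :=
  fun s => \sum_(t \in [set: int * int]) f t * g (s - t).

Definition monomial2 (a : A) (s : int * int) : series2 A :=
  fun t => if t == s then a else 0.

Definition const2 (a : A) : series2 A := monomial2 a (0, 0).
Definition lambda1 : series2 A := monomial2 1 (-1, 0).
Definition lambda2 : series2 A := monomial2 1 (0, -1).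

(* \sum_(p >= 0) lambda_i^(-p) c_p, for i = 1, 2 *)
Definition in_lambda1 (c : nat -> A) : series2 A :=
  fun s => if s is (Posz p, Posz 0) then c p else 0.
Definition in_lambda2 (c : nat -> A) : series2 A :=
  fun s => if s is (Posz 0, Posz p) then c p else 0.

End Series.

Declare Scope series_scope.
Delimit Scope series_scope with series.
Notation "f * g" := (series2_mul f g) : series_scope.

(* End(C^n) (x) End(C^n) (x) A is 'M[A]_(n * n); M (x) a is scale_tens M a. *)
Definition scale_tens (K : nzRingType) (A : lalgType K) (n : nat)
  (M : 'M[K]_n) (a : A) : 'M[A]_n := map_mx (fun c => c *: a) M.

Definition lie (A : pzRingType) (a b : A) : A := a * b - b * a.

Section Yangian.
Variables (K : comNzRingType) (k m : nat) (alpha : bool).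
Local Notation n := (k + m)%N.

(* X_k^+ = {k+1, ..., n}; indices in 'I_n start at 0. *)
Definition Xplus : pred 'I_n := fun x => (k <= x)%N.

Definition Pmx : 'M[K]_(n * n) :=
  \sum_(x < n) \sum_(y < n) delta_mx x y *t delta_mx y x.

Definition rmx : 'M[K]_(n * n) :=
  1%:M - (2 * alpha)%:R *: \sum_(x < n | Xplus x) delta_mx x x *t delta_mx x x.

(* The x such that h_x is a generator: X_k^+ if alpha = 1, none otherwise. *)
Definition hidx := {x : 'I_n | alpha && Xplus x}.

(* inl (p, x, y) stands for L^(p+1)_{x,y}, inr (inl x) for h_x and
   inr (inr x) for h_x^(-1). *)
Definition Ygen : choiceType := ((nat * 'I_n * 'I_n) + (hidx + hidx))%type.

Local Notation F := (free_alg K Ygen).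

Definition h (x : 'I_n) : F :=
  if insub x is Some z then free_gen K (inr (inl z) : Ygen) else 1.

Definition hinv (z : hidx) : F := free_gen K (inr (inr z) : Ygen).

Definition L (p : nat) (x y : 'I_n) : F :=
  if p is q.+1 then free_gen K (inl (q, x, y) : Ygen) else h x *+ (x == y).

Local Notation mat := 'M[F]_(n * n).

Definition R12 (lam : series2 mat) : series2 mat :=
  (lam * const2 (scale_tens rmx 1))%series + const2 (scale_tens Pmx 1).

Definition L1 : series2 mat := in_lambda1 (fun p =>
  \sum_(x < n) \sum_(y < n) scale_tens (delta_mx x y *t 1%:M) (L p x y)).

Definition L2 : series2 mat := in_lambda2 (fun p =>
  \sum_(x < n) \sum_(y < n) scale_tens (1%:M *t delta_mx x y) (L p x y)).

Variant h_invertible_rel : F -> F -> Prop :=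
| HMulV (z : hidx) : h_invertible_rel (h (val z) * hinv z) 1
| HVMul (z : hidx) : h_invertible_rel (hinv z * h (val z)) 1.

Variant rtt_rel : F -> F -> Prop :=
| RTT_h u v : h_invertible_rel u v -> rtt_rel u v
| RTT (s : int * int) (i j : 'I_(n * n)) :
    rtt_rel ((R12 (lambda1 mat - lambda2 mat) * L1 * L2)%series s i j)
            ((L2 * L1 * R12 (lambda1 mat - lambda2 mat))%series s i j).

Variant explicit_rel : F -> F -> Prop :=
| Explicit_h u v : h_invertible_rel u v -> explicit_rel u v
| Explicit_hh (x y : 'I_n) :
    alpha -> Xplus x -> Xplus y -> explicit_rel (lie (h x) (h y)) 0
| Explicit_Lh (p : nat) (x y z : 'I_n) :
    alpha -> Xplus z ->
    explicit_rel (lie (L p x y) (h z))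
                 (2%:R * L p x y * h x *+ (z == x)
                  - 2%:R * h y * L p x y *+ (z == y))
| Explicit_LL (p l : nat) (x y z w : 'I_n) :
    explicit_rel
      (lie (L p.+1 x y) (L l z w) - lie (L p x y) (L l.+1 z w)
       - (L p.+1 x y * L l x w - L p x y * L l.+1 x w)
           *+ (2 * alpha * (x == z) * Xplus x)
       + (L l z y * L p.+1 x y - L l.+1 z y * L p x y)
           *+ (2 * alpha * (y == w) * Xplus y))
      (L l z y * L p x w - L p z y * L l x w).

(* Y(g_alpha(k, m)) *)
Definition Yangian := presented_alg rtt_rel.

Definition explicit_Yangian := presented_alg explicit_rel.

End Yangian.

(* Main.v *)
From HB Require Import structures.
Require Import Defs.
From mathcomp Require Import all_boot all_order all_algebra generic_quotient.
From mathcomp Require Import mxtens complex.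
From mathcomp Require Import boolp classical_sets functions fsbigop reals.

Set Implicit Arguments.
Unset Strict Implicit.
Unset Printing Implicit Defensive.

Import GRing.Theory.
Local Open Scope ring_scope.
Local Open Scope quotient_scope.

(* The (a, b) coefficient of the RTT relation at the entry
   (x, z), (y, w) is computed explicitly, with the convention L^(p) = 0 for
   p < 0.  For a, b >= 0 it is literally the quadratic relation of the explicit
   presentation.  For a = -1 or b = -1 (the coefficients of a positive power of
   lambda_1 or lambda_2) only the products with L^(0) = diag(h) survive, and
   they give, up to sign, the commutation relations of h with the L^(p).  All
   other coefficients vanish.  Hence the two sets of relations generate the
   same two-sided ideal of the free algebra, and the quotients agree. *)

(** * Quotients by two-sided ideals whose generators lie in each other's ideal *)

Section Presentation.
Variables (K : nzRingType) (A : algType K).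

Lemma ideal_gen_sub (S T : set A) :
  (forall u, S u -> ideal_gen T u) -> forall u, ideal_gen S u -> ideal_gen T u.
Proof. by move=> ST u; apply; split; [exact: ideal_gen_ideal|exact: ST]. Qed.

Lemma ideal_gen_mem (S : set A) u : S u -> ideal_gen S u.
Proof. by move=> Su J [_]; apply. Qed.

Lemma ideal_gen0 (S : set A) : ideal_gen S 0.
Proof. by case: (ideal_gen_ideal S). Qed.

Lemma ideal_genN (S : set A) u : ideal_gen S u -> ideal_gen S (- u).
Proof. by case: (ideal_gen_ideal S) => _ _ + _ Ju; rewrite -mulN1r; apply. Qed.

(** The hypotheses force the two ideals to coincide, so passing through representatives is well
    defined in both directions and the two maps are mutually inverse. *)
Lemma alg_quot_isom (S T : set A) :
    (forall u, S u -> ideal_gen T u) -> (forall u, T u -> ideal_gen S u) ->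
  exists phi : {rmorphism alg_quot S -> alg_quot T},
    [/\ scalable phi, bijective phi
      & forall u, phi (\pi_(alg_quot S) u) = \pi_(alg_quot T) u].
Proof.
move=> /ideal_gen_sub ST /ideal_gen_sub TS.
pose phi (a : alg_quot S) : alg_quot T := \pi_(alg_quot T) (repr a).
pose psi (a : alg_quot T) : alg_quot S := \pi_(alg_quot S) (repr a).
have phiE u : phi (\pi_(alg_quot S) u) = \pi_(alg_quot T) u.
  by apply/eq_alg_quot; apply: ST; apply/eq_alg_quot; rewrite reprK.
have psiE u : psi (\pi_(alg_quot T) u) = \pi_(alg_quot S) u.
  by apply/eq_alg_quot; apply: TS; apply/eq_alg_quot; rewrite reprK.
have phiN : zmod_morphism phi.
  move=> a b; rewrite -[a]reprK -[b]reprK.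
  have piB V (u v : A) : \pi_(alg_quot V) u - \pi_(alg_quot V) v = \pi_(alg_quot V) (u - v).
    by rewrite pi_alg_quotD; congr (_ + _); exact: pi_quot_opp.
  by rewrite piB !phiE piB.
have phiM : monoid_morphism phi.
  split=> [|a b]; first exact: phiE.
  by rewrite -[a]reprK -[b]reprK -pi_alg_quotM !phiE pi_alg_quotM.
pose phiA := GRing.isZmodMorphism.Build _ _ phi phiN.
pose phiR := GRing.isMonoidMorphism.Build _ _ phi phiM.
pose f : {rmorphism alg_quot S -> alg_quot T} := HB.pack phi phiA phiR.
exists f; split=> //.
- by move=> c a; rewrite -[a]reprK -pi_alg_quotZ [LHS]phiE pi_alg_quotZ -phiE.
- exists psi => a; rewrite -[a]reprK; first by rewrite [f _]phiE psiE.
  by rewrite psiE [LHS]phiE.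
Qed.

End Presentation.

(** * Convolution with the linear series (lambda_1 - lambda_2) r + P *)

Section SeriesProduct.
Variable A : pzRingType.
Implicit Types (f g : series2 A) (s t u : int * int).

(** A sum of infinite support is 0 by convention, so each Cauchy product needs a certificate of
    finiteness: the list [r]. *)
Lemma series2_mulE (r : seq (int * int)) f g s : uniq r ->
    (forall t, t \notin r -> f t * g (s - t) = 0) ->
  (f * g)%series s = \sum_(t <- r) f t * g (s - t).
Proof.
move=> r_uniq fg0; rewrite /series2_mul (fsbigE r) //.
  by apply: eq_bigl => t; rewrite in_setT.
by move=> t _ /fg0.
Qed.

Variables r P : A.

Lemma linear_seriesE s :
  ((lambda1 A - lambda2 A) * const2 r)%series s + const2 P s
  = r *+ (s == (-1, 0)) - r *+ (s == (0, -1)) + P *+ (s == (0, 0)).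
Proof.
congr (_ + _); last by rewrite /const2 /monomial2; case: (s == _).
(* [const2 r] lives at exponent (0, 0), so only t = s contributes. *)
rewrite (@series2_mulE [:: s]) // => [|t]; last first.
  rewrite inE => t_neq_s; rewrite /const2 /monomial2 ifN ?mulr0 //.
  by rewrite subr_eq add0r eq_sym.
rewrite big_seq1 subrr /const2 /monomial2 eqxx mulrBl /lambda1 /lambda2.
by rewrite /monomial2; do 2![case: (s == _)]; rewrite ?mul1r ?mul0r.
Qed.

Variable R : series2 A.
Hypothesis RE : forall s,
  R s = r *+ (s == (-1, 0)) - r *+ (s == (0, -1)) + P *+ (s == (0, 0)).

Let subr_pair (a b a' b' : int) : (a, b) - (a', b') = (a - a', b - b').
Proof. by []. Qed.

Lemma linear_series_mul f (a b : int) :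
  (R * f)%series (a, b)
  = r * f (a + 1, b) - r * f (a, b + 1) + P * f (a, b).
Proof.
rewrite (@series2_mulE [:: (-1, 0); (0, -1); (0, 0)]) // => [|t]; last first.
  rewrite !inE !negb_or RE => /and3P[/negPf-> /negPf-> /negPf->].
  by rewrite !mulr0n subrr addr0 mul0r.
rewrite !big_cons big_nil !RE !subr_pair !opprK !subr0.
by rewrite /= ?mulr0n ?mulr1n ?subr0 ?addr0 ?add0r ?sub0r mulNr addrA.
Qed.

Lemma mul_linear_series f (a b : int) :
  (f * R)%series (a, b)
  = f (a + 1, b) * r - f (a, b + 1) * r + f (a, b) * P.
Proof.
(* The sum runs over exponents of the left factor, so the exponents of [R] are reflected by t -> (a,
   b) - t. *)
pose u := [:: (-1, 0); (0, -1); (0, 0)] : seq (int * int).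
rewrite (@series2_mulE [seq (a, b) - t | t <- u]) => [||t].
- rewrite big_map !big_cons big_nil !RE !subKr.
  rewrite !subr_pair !opprK !subr0.
  by rewrite /= ?mulr0n ?mulr1n ?subr0 ?addr0 ?add0r ?sub0r mulrN addrA.
- by rewrite map_inj_uniq //; exact: subrI.
- have sub_eqC v : ((a, b) - t == v) = (t == (a, b) - v).
    by rewrite subr_eq addrC -subr_eq eq_sym.
  rewrite !inE !negb_or RE => /and3P[t1 t2 t3].
  by rewrite !sub_eqC (negPf t1) (negPf t2) (negPf t3) !mulr0n subrr addr0 mulr0.
Qed.

Variables c d : nat -> A.
Local Notation ext e := (fun a : int => if a is Posz p then e p else 0).

Lemma in_lambda1E (a b : int) : in_lambda1 c (a, b) = ext c a *+ (b == 0).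
Proof. by case: a b => a [[|b]|b] //=; rewrite mul0rn. Qed.

Lemma in_lambda2E (a b : int) : in_lambda2 d (a, b) = ext d b *+ (a == 0).
Proof. by case: a b => [[|a]|a] [b|b] //=; rewrite mul0rn. Qed.

Lemma linear_series_mul12 (a b : int) :
  (R * in_lambda1 c * in_lambda2 d)%series (a, b)
  = r * (ext c (a + 1) * ext d b) - r * (ext c a * ext d (b + 1))
    + P * (ext c a * ext d b).
Proof.
(* The last factor contains only lambda_2, which forces t1 = a. The series of [c] contains only
   lambda_1, so t2 comes from [R] alone and is 0 or -1. *)
rewrite (@series2_mulE [:: (a, 0); (a, -1)]) => [||[t1 t2]] //.
- rewrite !big_cons big_nil !linear_series_mul !in_lambda1E !subr_pair.
  rewrite !in_lambda2E !subrr !subr0 !opprK.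
  rewrite /= ?mulr0n ?mulr1n ?mulr0 ?subr0 ?addr0 ?add0r ?sub0r.
  by rewrite mulrDl mulNr !mulrA addrAC.
- by rewrite /= inE xpair_eqE eqxx.
rewrite !inE !xpair_eqE linear_series_mul !in_lambda1E in_lambda2E.
rewrite subr_eq0 (eq_sym a) addr_eq0 -andb_orr.
case: (t1 == a) => /=; last by rewrite mulr0n mulr0.
rewrite negb_or => /andP[/negPf-> /negPf->].
by rewrite !mulr0n !mulr0 subrr addr0 mul0r.
Qed.

Lemma mul21_linear_series (a b : int) :
  (in_lambda2 d * in_lambda1 c * R)%series (a, b)
  = ext d b * ext c (a + 1) * r - ext d (b + 1) * ext c a * r
    + ext d b * ext c a * P.
Proof.
(* The two series involve different variables, so each coefficient is a single product. *)
have mul21 (a' b' : int) :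
    (in_lambda2 d * in_lambda1 c)%series (a', b') = ext d b' * ext c a'.
  rewrite (@series2_mulE [:: (0, b')]) => [||[t1 t2]] //.
    by rewrite big_seq1 subr_pair in_lambda2E in_lambda1E subr0 subrr.
  rewrite inE xpair_eqE in_lambda2E in_lambda1E subr_eq0 (eq_sym b').
  by do 2![case: (_ == _) => //=]; rewrite !(mulr0n, mul0r, mulr0).
by rewrite mul_linear_series !mul21.
Qed.

End SeriesProduct.

(** * Sums over the tensor basis *)

Section TensorSums.
Variables (A : pzRingType) (n : nat).

Lemma sum_delta2 (x y : 'I_n) (f : 'I_n -> 'I_n -> A) :
  \sum_(u < n) \sum_(v < n) ((x == u) && (y == v))%:R * f u v = f x y.
Proof.
rewrite (bigD1 x) //= (bigD1 y) //= !eqxx mul1r big1 => [|v /negPf].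
  rewrite addr0 big1 ?addr0 // => u /negPf; rewrite eq_sym => ->.
  by rewrite big1 // => v _; rewrite mul0r.
by rewrite eq_sym => ->; rewrite mul0r.
Qed.

Lemma sum_mxtens (f : 'I_(n * n) -> A) :
  \sum_i f i = \sum_(x < n) \sum_(y < n) f (mxtens_index (x, y)).
Proof.
rewrite pair_big /= (reindex (@mxtens_index n n)) /=.
  by apply: eq_bigr => -[].
by exists (@mxtens_unindex n n) => i _;
   rewrite (mxtens_indexK, mxtens_unindexK).
Qed.

End TensorSums.

(** * Matrix entries of the coefficients of L_1 and L_2 *)

Section TensorEntries.
Variables (K : comNzRingType) (A : algType K) (n : nat).
Implicit Types (l : 'I_n -> 'I_n -> A) (x y z w : 'I_n) (M : 'M[A]_(n * n)).

Definition tens1 l : 'M[A]_(n * n) :=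
  \sum_(x < n) \sum_(y < n) scale_tens (delta_mx x y *t (1%:M : 'M[K]_n)) (l x y).

Definition tens2 l : 'M[A]_(n * n) :=
  \sum_(x < n) \sum_(y < n) scale_tens ((1%:M : 'M[K]_n) *t delta_mx x y) (l x y).

Lemma tens1E l x z y w :
  tens1 l (mxtens_index (x, z)) (mxtens_index (y, w)) = (z == w)%:R * l x y.
Proof.
rewrite -(sum_delta2 x y (fun u v => (z == w)%:R * l u v)) summxE.
apply: eq_bigr => u _; rewrite summxE; apply: eq_bigr => v _.
rewrite mxE tensmxE !mxE.
by case: (_ && _) (z == w) => [] []; rewrite !(mul1r, mul0r) (scale1r, scale0r).
Qed.

Lemma tens2E l x z y w :
  tens2 l (mxtens_index (x, z)) (mxtens_index (y, w)) = (x == y)%:R * l z w.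
Proof.
rewrite -(sum_delta2 z w (fun u v => (x == y)%:R * l u v)) summxE.
apply: eq_bigr => u _; rewrite summxE; apply: eq_bigr => v _.
rewrite mxE tensmxE !mxE.
by case: (_ && _) (x == y) => [] []; rewrite !(mul1r, mul0r) (scale1r, scale0r).
Qed.

(** L_1 fixes the second index and L_2 the first, so the only intermediate basis index is (y, z). *)
Lemma tens1_tens2E l l' x z y w :
  (tens1 l *m tens2 l') (mxtens_index (x, z)) (mxtens_index (y, w))
  = l x y * l' z w.
Proof.
rewrite mxE sum_mxtens -(sum_delta2 y z (fun u v => l x u * l' v w)).
apply: eq_bigr => u _; apply: eq_bigr => v _; rewrite tens1E tens2E.
by case: (z == v); case: eqVneq => [->|]; rewrite ?eqxx ?mul0r ?mul1r ?mulr0.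
Qed.

(** Here the only intermediate index is (x, w). *)
Lemma tens2_tens1E l l' x z y w :
  (tens2 l' *m tens1 l) (mxtens_index (x, z)) (mxtens_index (y, w))
  = l' z w * l x y.
Proof.
rewrite mxE sum_mxtens -(sum_delta2 x w (fun u v => l' z v * l u y)).
apply: eq_bigr => u _; apply: eq_bigr => v _; rewrite tens1E tens2E.
by case: (x == u); case: eqVneq => [->|]; rewrite ?eqxx ?mul0r ?mul1r ?mulr0.
Qed.

End TensorEntries.

(** * Action of r and P on rows and columns *)

Section RTTEntries.
Variables (K : comNzRingType) (k m : nat) (alpha : bool) (A : algType K).
Local Notation n := (k + m)%N.
Local Notation r := (scale_tens (rmx K k m alpha) (1 : A)).
Local Notation P := (scale_tens (Pmx K k m) (1 : A)).
Implicit Types (x y z w : 'I_n) (M : 'M[A]_(n * n)).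

(* The diagonal coefficient of r at the basis vector (x, y) is
   1 - rdefect x y. *)
Definition rdefect x y : nat := (2 * alpha * (x == y) * Xplus x)%N.

Lemma mxtens_index_eq x z y w :
  (mxtens_index (x, z) == mxtens_index (y, w)) = (x == y) && (z == w).
Proof. by rewrite (can_eq (@mxtens_indexK _ _)). Qed.

Lemma PmxE x z y w :
  Pmx K k m (mxtens_index (x, z)) (mxtens_index (y, w))
  = ((z == y) && (x == w))%:R.
Proof.
rewrite (eq_sym z) (eq_sym x).
rewrite -(sum_delta2 x y (fun u v => ((v == z) && (w == u))%:R)) summxE.
apply: eq_bigr => u _; rewrite summxE; apply: eq_bigr => v _.
by rewrite tensmxE !mxE (eq_sym v).
Qed.

(** In row (x, z) only the summand v = x of [rmx] can contribute, and it does so on the diagonal,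
    when x = z lies in X_k^+. *)
Lemma rmxE x z i :
  rmx K k m alpha (mxtens_index (x, z)) i
  = (1 - (rdefect x z)%:R) *+ (mxtens_index (x, z) == i).
Proof.
case: (mxtens_indexP i) => {i} y w; rewrite /rmx !mxE summxE.
have -> : \sum_(v < n | Xplus v)
    (delta_mx v v *t delta_mx v v : 'M[K]_(n * n))
      (mxtens_index (x, z)) (mxtens_index (y, w))
    = ((x == z) && Xplus x && ((x == y) && (z == w)))%:R.
  rewrite big_mkcond (bigD1 x) //= big1 ?addr0 => [|v /negPf v_x].
    rewrite tensmxE !mxE eqxx -natrM mulnb.
    rewrite (eq_sym y) (eq_sym w) (eq_sym z).
    case: (Xplus x); last by rewrite andbF.
    by rewrite andbT /=; case: (eqVneq x z) => [<-|]; rewrite ?andbF.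
  by rewrite tensmxE !mxE (eq_sym x) v_x mul0r if_same.
rewrite mxtens_index_eq /rdefect -natrM.
case: (_ && (z == w)); first by rewrite andbT -mulnb mulnA.
by rewrite andbF muln0 subrr.
Qed.

(** Since r is diagonal, its coefficient can be read off the column index, as right multiplication
    requires. *)
Lemma rmxEr i y w :
  rmx K k m alpha i (mxtens_index (y, w))
  = (1 - (rdefect y w)%:R) *+ (i == mxtens_index (y, w)).
Proof.
case: (mxtens_indexP i) => {i} x z.
by rewrite rmxE mxtens_index_eq; case: eqVneq => //= ->; case: eqVneq => //= ->.
Qed.

Lemma mul_scale_PmxE M x z i :
  (P *m M) (mxtens_index (x, z)) i = M (mxtens_index (z, x)) i.
Proof.
rewrite mxE sum_mxtens -[RHS](sum_delta2 z x (fun u v => M (mxtens_index (u, v)) i)).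
apply: eq_bigr => u _; apply: eq_bigr => v _.
by rewrite mxE PmxE; congr (_ * _); rewrite scaler_nat.
Qed.

Lemma mul_mx_scale_PmxE M y w i :
  (M *m P) i (mxtens_index (y, w)) = M i (mxtens_index (w, y)).
Proof.
rewrite mxE sum_mxtens -[RHS](sum_delta2 w y (fun u v => M i (mxtens_index (u, v)))).
apply: eq_bigr => u _; apply: eq_bigr => v _.
rewrite mxE PmxE (eq_sym v) (eq_sym u) andbC.
by case: (_ && _); rewrite ?scale1r ?scale0r ?mulr1 ?mulr0 ?mul1r ?mul0r.
Qed.

Lemma mul_scale_rmxE M x z i :
  (r *m M) (mxtens_index (x, z)) i
  = M (mxtens_index (x, z)) i - M (mxtens_index (x, z)) i *+ rdefect x z.
Proof.
rewrite mxE (bigD1 (mxtens_index (x, z))) //= big1 => [|j /negPf j_xz].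
  by rewrite mxE rmxE eqxx addr0 mulr1n scalerBl scale1r scaler_nat
             mulrBl mul1r mulr_natl.
by rewrite mxE rmxE eq_sym j_xz mulr0n scale0r mul0r.
Qed.

Lemma mul_mx_scale_rmxE M y w i :
  (M *m r) i (mxtens_index (y, w))
  = M i (mxtens_index (y, w)) - M i (mxtens_index (y, w)) *+ rdefect y w.
Proof.
rewrite mxE (bigD1 (mxtens_index (y, w))) //= big1 => [|j /negPf j_yw].
  by rewrite mxE rmxEr eqxx addr0 mulr1n scalerBl scale1r scaler_nat
             mulrBr mulr1 mulr_natr.
by rewrite mxE rmxEr j_yw mulr0n scale0r mulr0.
Qed.

Implicit Types f g : 'I_n -> 'I_n -> A.

Let mxBE M N i j : (M - N) i j = M i j - N i j.
Proof. by rewrite !mxE. Qed.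

(** Both terms with r carry the coefficient of row (x, z), so they are treated as one product; P
    exchanges the row indices x and z. *)
Lemma rtt_left_entry f f' g g' x z y w :
  (r *m (tens1 f' *m tens2 g) - r *m (tens1 f *m tens2 g')
   + P *m (tens1 f *m tens2 g)) (mxtens_index (x, z)) (mxtens_index (y, w))
  = (f' x y * g z w - f x y * g' z w)
    - (f' x y * g z w - f x y * g' z w) *+ rdefect x z + f z y * g x w.
Proof.
rewrite -mulmxBr mxE mul_scale_rmxE mul_scale_PmxE tens1_tens2E.
by rewrite mxBE !tens1_tens2E.
Qed.

(** On the right, r contributes the coefficient of column (y, w), and P exchanges y and w. *)
Lemma rtt_right_entry f f' g g' x z y w :
  ((tens2 g *m tens1 f') *m r - (tens2 g' *m tens1 f) *m r
   + (tens2 g *m tens1 f) *m P) (mxtens_index (x, z)) (mxtens_index (y, w))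
  = (g z w * f' x y - g' z w * f x y)
    - (g z w * f' x y - g' z w * f x y) *+ rdefect y w + g z y * f x w.
Proof.
rewrite -mulmxBl mxE mul_mx_scale_rmxE mul_mx_scale_PmxE tens2_tens1E.
by rewrite mxBE !tens2_tens1E.
Qed.

End RTTEntries.

(** * Coefficients of the two sides of the RTT relation *)

Section RTTCoefficients.
Variables (K : comNzRingType) (k m : nat) (alpha : bool).
Local Notation n := (k + m)%N.
Local Notation F := (free_alg K (Ygen k m alpha)).
Local Notation mat := 'M[F]_(n * n).
Local Notation R12 := (@R12 K k m alpha (lambda1 mat - lambda2 mat)).
Local Notation L1 := (@L1 K k m alpha).
Local Notation L2 := (@L2 K k m alpha).

Definition Lz (a : int) (x y : 'I_n) : F :=
  if a is Posz p then L K alpha p x y else 0.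

(** Moves the zero extension outside the matrix, the form in which coefficients occur in the
    convolution formulas. *)
Lemma tens1_Lz (a : int) :
  tens1 (Lz a)
  = if a is Posz p then
      \sum_(x < n) \sum_(y < n) scale_tens (delta_mx x y *t 1%:M) (L K alpha p x y)
    else 0.
Proof.
case: a => // p; apply: big1 => x _; apply: big1 => y _.
by apply/matrixP => i j; rewrite !mxE scaler0.
Qed.

Lemma tens2_Lz (a : int) :
  tens2 (Lz a)
  = if a is Posz p then
      \sum_(x < n) \sum_(y < n) scale_tens (1%:M *t delta_mx x y) (L K alpha p x y)
    else 0.
Proof.
case: a => // p; apply: big1 => x _; apply: big1 => y _.
by apply/matrixP => i j; rewrite !mxE scaler0.
Qed.

Local Notation r := (scale_tens (rmx K k m alpha) 1 : mat).
Local Notation P := (scale_tens (Pmx K k m) 1 : mat).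

Lemma R12E s :
  R12 s = r *+ (s == (-1, 0)) - r *+ (s == (0, -1)) + P *+ (s == (0, 0)).
Proof. exact: (@linear_seriesE mat r P s). Qed.

Lemma R12_L1_L2 (a b : int) :
  (R12 * L1 * L2)%series (a, b)
  = r *m (tens1 (Lz (a + 1)) *m tens2 (Lz b))
    - r *m (tens1 (Lz a) *m tens2 (Lz (b + 1)))
    + P *m (tens1 (Lz a) *m tens2 (Lz b)).
Proof.
rewrite !tens1_Lz !tens2_Lz.
exact: (@linear_series_mul12 mat r P R12 R12E).
Qed.

Lemma L2_L1_R12 (a b : int) :
  (L2 * L1 * R12)%series (a, b)
  = (tens2 (Lz b) *m tens1 (Lz (a + 1))) *m r
    - (tens2 (Lz (b + 1)) *m tens1 (Lz a)) *m r
    + (tens2 (Lz b) *m tens1 (Lz a)) *m P.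
Proof.
rewrite !tens1_Lz !tens2_Lz.
exact: (@mul21_linear_series mat r P R12 R12E).
Qed.

Lemma R12_L1_L2E (a b : int) (x z y w : 'I_n) :
  (R12 * L1 * L2)%series (a, b) (mxtens_index (x, z)) (mxtens_index (y, w))
  = (Lz (a + 1) x y * Lz b z w - Lz a x y * Lz (b + 1) z w)
    - (Lz (a + 1) x y * Lz b z w - Lz a x y * Lz (b + 1) z w)
        *+ rdefect alpha x z
    + Lz a z y * Lz b x w.
Proof.
rewrite R12_L1_L2; exact: rtt_left_entry.
Qed.

Lemma L2_L1_R12E (a b : int) (x z y w : 'I_n) :
  (L2 * L1 * R12)%series (a, b) (mxtens_index (x, z)) (mxtens_index (y, w))
  = (Lz b z w * Lz (a + 1) x y - Lz (b + 1) z w * Lz a x y)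
    - (Lz b z w * Lz (a + 1) x y - Lz (b + 1) z w * Lz a x y)
        *+ rdefect alpha y w
    + Lz b z y * Lz a x w.
Proof.
rewrite L2_L1_R12; exact: rtt_right_entry.
Qed.

End RTTCoefficients.

(* This is (1 - 2a) u v - (1 - 2b) v u: a commutator up to sign if a = b, and an
   anticommutator up to sign otherwise, whence scaled_lieC. *)
Definition scaled_lie (A : pzRingType) (a b : bool) (u v : A) : A :=
  u * v - u * v *+ (2 * a) - (v * u - v * u *+ (2 * b)).

Lemma scaled_lie0 (A : pzRingType) (u v : A) :
  scaled_lie false false u v = lie u v.
Proof. by rewrite /scaled_lie !muln0 !mulr0n !subr0. Qed.

Lemma scaled_lieC (A : pzRingType) a b (u v : A) :
  scaled_lie a b u v = scaled_lie b a u v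
  \/ scaled_lie a b u v = - scaled_lie b a u v.
Proof.
case: a b => [] []; [by left|right|right|by left];
  rewrite /scaled_lie !muln0 !muln1 !mulr0n !subr0 !mulr2n !opprD !opprK
    !addrA.
- by rewrite subrr sub0r addrK.
- by rewrite subrK addNr add0r.
Qed.

Lemma rdefectC k m alpha (x y : 'I_(k + m)) :
  rdefect alpha x y = rdefect alpha y x.
Proof. by rewrite /rdefect; case: eqVneq => [->|]; rewrite ?eqxx ?muln0. Qed.

(** * A single entry of the RTT relation, in general and at the poles *)

Section RTTEntryRelations.
Variables (k m : nat) (alpha : bool) (A : pzRingType).
Local Notation n := (k + m)%N.
Implicit Types (x y z w : 'I_n) (f g : 'I_n -> 'I_n -> A).

(* f, f', g, g' stand for the coefficients of L of orders a, a + 1, b, b + 1. *)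
Definition rtt_entry f f' g g' x y z w : A :=
  (f' x y * g z w - f x y * g' z w)
    - (f' x y * g z w - f x y * g' z w) *+ rdefect alpha x z
    + f z y * g x w
  - ((g z w * f' x y - g' z w * f x y)
       - (g z w * f' x y - g' z w * f x y) *+ rdefect alpha y w
     + g z y * f x w).

Lemma rtt_entryE f f' g g' x y z w :
  rtt_entry f f' g g' x y z w
  = lie (f' x y) (g z w) - lie (f x y) (g' z w)
    - (f' x y * g x w - f x y * g' x w) *+ (2 * alpha * (x == z) * Xplus x)
    + (g z y * f' x y - g' z y * f x y) *+ (2 * alpha * (y == w) * Xplus y)
    - (g z y * f x w - f z y * g x w).
Proof.
have -> : (f' x y * g x w - f x y * g' x w) *+ (2 * alpha * (x == z) * Xplus x)
    = (f' x y * g z w - f x y * g' z w) *+ rdefect alpha x z.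
  by rewrite /rdefect; case: eqVneq => [->|_]; rewrite ?muln0.
have -> : (g z y * f' x y - g' z y * f x y) *+ (2 * alpha * (y == w) * Xplus y)
    = (g z w * f' x y - g' z w * f x y) *+ rdefect alpha y w.
  by rewrite /rdefect; case: eqVneq => [->|_]; rewrite ?muln0.
rewrite /rtt_entry /lie !opprD !opprK !addrA.
(* Pairs the products into commutators and moves the two terms coming from P to the end. *)
by rewrite [LHS](ACl (1*5*2*6*3*7*8*4)).
Qed.

(** Every product pairs f' with g, f with g', or f with g, so each alternative kills all of them.
    The alternatives arise for a < -1, for b < -1, and for a, b < 0. *)
Lemma rtt_entry0 f f' g g' x y z w (o := fun _ _ => 0) :
  [\/ f = o /\ f' = o, g = o /\ g' = o | f = o /\ g = o] ->
  rtt_entry f f' g g' x y z w = 0.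
Proof.
by case=> -[-> ->]; rewrite /rtt_entry /o !(mul0r, mulr0) !subrr !mul0rn
  !(addr0, subr0).
Qed.

Variable h : 'I_n -> A.
Hypothesis h_eq1 : forall x, ~~ (alpha && Xplus x) -> h x = 1.

Let rdefect_gt0 x y : alpha -> Xplus x -> rdefect alpha x y = (2 * (x == y))%N.
Proof. by rewrite /rdefect => -> ->; rewrite !muln1. Qed.

Let rdefect_eq0 x y : ~~ (alpha && Xplus x) -> rdefect alpha x y = 0%N.
Proof. by rewrite /rdefect negb_and => /orP[] /negPf->; rewrite ?muln0 ?mul0n. Qed.

(** Only f' = diag(h) survives, which forces x = y. Where h_x = 1 the defects vanish and 1 is
    central; elsewhere the row and column defects become the two flags of [scaled_lie]. *)
Lemma rtt_entry_pole1 g g' x y z w :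
  rtt_entry (fun _ _ => 0) (fun x y => h x *+ (x == y)) g g' x y z w
  = if [&& alpha, Xplus x & x == y] then
      scaled_lie (x == z) (x == w) (h x) (g z w) else 0.
Proof.
rewrite /rtt_entry !mul0r !mulr0 !subr0 !addr0.
case: (eqVneq x y) => [<-|_]; last first.
  by rewrite !andbF !mulr0n mul0r mulr0 !mul0rn !subrr.
rewrite andbT; case: ifPn => [/andP[alphaT x_gt_k]|nx].
  by rewrite !mulr1n !rdefect_gt0.
by rewrite !rdefect_eq0 // h_eq1 // !mulr0n mul1r mulr1 subrr.
Qed.

(** Now h_z comes from L_2, with the sign of -lambda_2: h_z stands on the left in the products of
    L_2 L_1, so the column flag comes first. *)
Lemma rtt_entry_pole2 f f' x y z w :
  rtt_entry f f' (fun _ _ => 0) (fun x y => h x *+ (x == y)) x y z w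
  = if [&& alpha, Xplus z & z == w] then
      scaled_lie (z == y) (z == x) (h z) (f x y) else 0.
Proof.
rewrite /rtt_entry !mul0r !mulr0 !sub0r !addr0.
case: (eqVneq z w) => [<-|_]; last first.
  by rewrite !andbF !mulr0n mul0r mulr0 !oppr0 !mul0rn !subrr.
rewrite andbT !(rdefectC _ _ z); case: ifPn => [/andP[alphaT z_gt_k]|nz].
  by rewrite !mulr1n !rdefect_gt0 // /scaled_lie !mulNrn !opprD !opprK addrC.
by rewrite !rdefect_eq0 // h_eq1 // !mulr0n mul1r mulr1 subrr.
Qed.

(** Under the deltas h_x and h_y become h_z, so the correction terms are multiples of u h_z and h_z
    u. *)
Lemma lie_scaled_lie x y z (u : A) :
  lie u (h z) - (2%:R * u * h x *+ (z == x) - 2%:R * h y * u *+ (z == y))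
  = - scaled_lie (z == y) (z == x) (h z) u.
Proof.
have -> : 2%:R * u * h x *+ (z == x) = u * h z *+ (2 * (z == x)).
  by case: eqVneq => [->|_]; rewrite ?muln0 // muln1 mulr1n -mulrA mulr_natl.
have -> : 2%:R * h y * u *+ (z == y) = h z * u *+ (2 * (z == y)).
  by case: eqVneq => [->|_]; rewrite ?muln0 // muln1 mulr1n -mulrA mulr_natl.
rewrite /scaled_lie /lie !opprD !opprK !addrA.
by rewrite [LHS](ACl (2*4*1*3)).
Qed.

End RTTEntryRelations.

(** * Equality of the two ideals of relations *)

Section RelationComparison.
Variables (K : comNzRingType) (k m : nat) (alpha : bool).
Local Notation n := (k + m)%N.
Local Notation F := (free_alg K (Ygen k m alpha)).
Local Notation mat := 'M[F]_(n * n).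
Local Notation R12 := (@R12 K k m alpha (lambda1 mat - lambda2 mat)).
Local Notation L1 := (@L1 K k m alpha).
Local Notation L2 := (@L2 K k m alpha).
Local Notation L := (@L K k m alpha).
Local Notation h := (@h K k m alpha).
Local Notation Lz := (@Lz K k m alpha).
Implicit Types (p l : nat) (x y z w : 'I_n).

Definition rtt_diff (a b : int) x y z w : F :=
  (R12 * L1 * L2)%series (a, b) (mxtens_index (x, z)) (mxtens_index (y, w))
  - (L2 * L1 * R12)%series (a, b) (mxtens_index (x, z)) (mxtens_index (y, w)).

Lemma rtt_diffE (a b : int) x y z w :
  rtt_diff a b x y z w
  = rtt_entry alpha (Lz a) (Lz (a + 1)) (Lz b) (Lz (b + 1)) x y z w.
Proof. by congr (_ - _); [exact: R12_L1_L2E|exact: L2_L1_R12E]. Qed.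

Lemma h_eq1 x : ~~ (alpha && Xplus x) -> h x = 1.
Proof. by move=> nx; rewrite /Defs.h insubN. Qed.

Lemma rtt_diff_nat p l x y z w :
  rtt_diff p l x y z w
  = lie (L p.+1 x y) (L l z w) - lie (L p x y) (L l.+1 z w)
    - (L p.+1 x y * L l x w - L p x y * L l.+1 x w)
        *+ (2 * alpha * (x == z) * Xplus x)
    + (L l z y * L p.+1 x y - L l.+1 z y * L p x y)
        *+ (2 * alpha * (y == w) * Xplus y)
    - (L l z y * L p x w - L p z y * L l x w).
Proof.
have posS (q : nat) : q%:Z + 1 = q.+1%:Z by rewrite -PoszD addn1.
by rewrite rtt_diffE !posS; exact: rtt_entryE.
Qed.

(* Negz 0 is -1: this is the coefficient of lambda_1^1 lambda_2^(-l). *)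
Lemma rtt_diff_pole1 l x y z w :
  rtt_diff (Negz 0) l x y z w
  = if [&& alpha, Xplus x & x == y] then
      scaled_lie (x == z) (x == w) (h x) (L l z w) else 0.
Proof. by rewrite rtt_diffE; exact: (rtt_entry_pole1 h_eq1). Qed.

Lemma rtt_diff_pole2 p x y z w :
  rtt_diff p (Negz 0) x y z w
  = if [&& alpha, Xplus z & z == w] then
      scaled_lie (z == y) (z == x) (h z) (L p x y) else 0.
Proof. by rewrite rtt_diffE; exact: (rtt_entry_pole2 h_eq1). Qed.

Local Notation rtt := (@rtt_rel K k m alpha).
Local Notation explicit := (@explicit_rel K k m alpha).
Local Notation ideal E :=
  (ideal_gen [set d | exists u v, E u v /\ d = u - v]%classic).

Lemma rel_mem (E : F -> F -> Prop) u v : E u v -> ideal E (u - v).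
Proof. by move=> Euv; apply: ideal_gen_mem; exists u, v. Qed.

Lemma rtt_diff_mem (a b : int) x y z w : ideal rtt (rtt_diff a b x y z w).
Proof. exact: (rel_mem (RTT K alpha (a, b) _ _)). Qed.

(** The pole in lambda_1 yields the flags in the opposite order from the explicit relation; swapping
    them changes at most a sign. *)
Lemma scaled_lie_mem J p x y z :
  (ideal_gen J (scaled_lie (z == x) (z == y) (h z) (L p x y))
   <-> ideal_gen J (scaled_lie (z == y) (z == x) (h z) (L p x y))).
Proof.
by case: (scaled_lieC (z == x) (z == y) (h z) (L p x y)) => ->;
  split=> // /ideal_genN; rewrite ?opprK.
Qed.

Lemma explicit_sub_rtt u v : explicit u v -> ideal rtt (u - v).
Proof.
case=> {u v} [u v uv|x y alphaT x_gt_k y_gt_k|p x y z alphaT z_gt_k|p l x y z w].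
- by apply: rel_mem; exact: RTT_h.
(* Coefficient of lambda_1 lambda_2^0 at the diagonal entry (x, y), (x, y). *)
- have := rtt_diff_mem (Negz 0) 0 x x y y; rewrite rtt_diff_pole1.
  rewrite ifT; last by rewrite alphaT x_gt_k eqxx.
  rewrite subr0 (_ : L 0 y y = h y); last by rewrite /Defs.L eqxx.
  (* For x = y the commutator is 0 anyway; otherwise both flags are false. *)
  case: (eqVneq x y) => [-> _|_]; first by rewrite /lie subrr; exact: ideal_gen0.
  by rewrite scaled_lie0.
(* Coefficient of lambda_1^(-p) lambda_2 at the entry (x, z), (y, z). *)
- have := rtt_diff_mem p (Negz 0) x y z z; rewrite rtt_diff_pole2.
  rewrite ifT; last by rewrite alphaT z_gt_k eqxx.
  by rewrite lie_scaled_lie => /ideal_genN.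
- by rewrite -rtt_diff_nat; exact: rtt_diff_mem.
Qed.

Lemma scaled_lie_explicit p x y z : alpha -> Xplus z ->
  ideal explicit (scaled_lie (z == y) (z == x) (h z) (L p x y)).
Proof.
move=> alphaT z_gt_k; rewrite -[scaled_lie _ _ _ _]opprK -lie_scaled_lie.
apply: ideal_genN; exact: (rel_mem (Explicit_Lh K p x y alphaT z_gt_k)).
Qed.

Lemma rtt_sub_explicit u v : rtt u v -> ideal explicit (u - v).
Proof.
case=> {u v} [u v uv|[a b] i j].
  by apply: rel_mem; exact: Explicit_h.
case: (mxtens_indexP i) => {i} x z; case: (mxtens_indexP j) => {j} y w.
rewrite -/(rtt_diff a b x y z w).
(* Each of a and b is nonnegative, equal to -1, or at most -2. *)
case: a b => [p|[|p]] [l|[|l]];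
  rewrite ?(rtt_diff_nat, rtt_diff_pole1, rtt_diff_pole2, rtt_diffE).
- exact: (rel_mem (Explicit_LL K alpha p l x y z w)).
- case: ifP => [/and3P[? ? _]|_]; last exact: ideal_gen0.
  exact: scaled_lie_explicit.
- by rewrite rtt_entry0; [exact: ideal_gen0|constructor 2].
- case: ifP => [/and3P[? ? _]|_]; last exact: ideal_gen0.
  by apply/scaled_lie_mem; exact: scaled_lie_explicit.
(* What remains has both orders negative, or a < -1 and b >= 0. *)
all: rewrite rtt_entry0; first exact: ideal_gen0.
all: solve [by constructor 3 | by constructor 1].
Qed.

End RelationComparison.

Theorem theorem2p3 (R : realType) (k m : nat) (alpha : bool) (m_gt0 : (0 < m)%N) :
  exists phi : {rmorphism Yangian R[i] k m alpha -> explicit_Yangian R[i] k m alpha},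
    [/\ scalable phi,
        bijective phi
      & forall g : Ygen k m alpha,
          phi (pres_gen (@rtt_rel R[i] k m alpha) g)
          = pres_gen (@explicit_rel R[i] k m alpha) g].
Proof.
have [| |phi [phiZ phi_bij phiE]] := @alg_quot_isom _ _
  [set d | exists u v, @rtt_rel R[i] k m alpha u v /\ d = u - v]%classic
  [set d | exists u v, @explicit_rel R[i] k m alpha u v /\ d = u - v]%classic.
- by move=> _ [u [v [/rtt_sub_explicit uv ->]]].
- by move=> _ [u [v [/explicit_sub_rtt uv ->]]].
(* The isomorphism is induced by the identity of the free algebra, so it matches generators. *)
- by exists phi; split=> // g; exact: phiE.
Qed.
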